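(* For every real $x>0$, $$\exp\left(x\,\psi\left(\frac{x}{2}+1-\frac{x^2}{12+2x}\right)\right)<\Gamma(x+1)<\exp\left(x\,\psi\left(\frac{x}{2}+1\right)\right).$$
   Context: $\Gamma$ is the classical Euler gamma function and $\psi(x)=\Gamma'(x)/\Gamma(x)$ for $x>0$ is the digamma function. *)

(* Defs.v *)
From mathcomp Require Import all_boot all_order all_algebra.
From mathcomp Require Import all_classical all_reals all_analysis.

Set Implicit Arguments.
Unset Strict Implicit.
Unset Printing Implicit Defensive.

Import Order.TTheory GRing.Theory Num.Theory.
Import numFieldNormedType.Exports.

Local Open Scope classical_set_scope.
Local Open Scope ring_scope.

(* Euler's integral of the second kind. It converges exactly when 0 < x;
   for x <= 0 the value is junk (it is not the analytic continuation). *)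
Definition Gamma (R : realType) (x : R) : R :=
  \int[lebesgue_measure]_(t in `]0, +oo[) (t `^ (x - 1) * expR (- t)).

(* As for [Gamma], only values at 0 < x are meaningful. *)
Definition digamma (R : realType) (x : R) : R :=
  (@Gamma R)^`()%classic x / Gamma x.

(* Main.v *)
(* For [0 < u <= x], the functional equations of [Gamma] and [digamma] give
     ln (Gamma (x+1)) - x digamma (u+1)
       = B_N - \sum_(1 <= m <= N) (ln (1 + x/m) - x / (u + m)),
   where B_N = ln (Gamma (N+1+x)) - ln (Gamma (N+1)) - x digamma (N+1+u) is
   O(1/N) by the mean value theorem and ln (z-1) <= digamma z <= ln z. The
   latter follows by integrating the tangent-line bounds for [ln t] against
   [t `^ (z-1) * expR (-t)]. It remains to see that all summands have the same
   sign: for u = x/2 they are positive because 2y/(2+y) < ln (1+y), and for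
   u = 3x/(6+x) = x/2 - x^2/(12+2x) they are negative because
   ln (1+y) < y(6+y)/(6+4y), where y = x/m. *)
Require Import Defs.
From mathcomp Require Import all_boot all_order all_algebra.
From mathcomp Require Import all_classical all_reals all_analysis.
From mathcomp Require Import ring lra measurable_realfun.

Import Order.TTheory GRing.Theory Num.Theory.
Import numFieldNormedType.Exports.

Local Open Scope ring_scope.
Local Open Scope classical_set_scope.

(** * Elementary inequalities for the logarithm and the exponential *)

Section ElementaryBounds.
Context {R : realType}.

(** Take logarithms and use [ln s <= s] at [s = t / (2 * z + 1)]: the cost [z * s] is at most
    [t / 2]. The [+ 1] keeps the base positive at [z = 0]. This supplies an integrable majorant of
    Euler's integrand. *)
Lemma powR_expRN_le (z t : R) : 0 <= z -> 0 < t ->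
  t `^ z * expR (- t) <= (2 * z + 1) `^ z * expR (- (t / 2)).
Proof.
move=> z0 t0; have c0 : 0 < 2 * z + 1 by lra.
rewrite /powR !gt_eqF// -!expRD ler_expR.
have : ln (t / (2 * z + 1)) <= t / (2 * z + 1).
  by apply/ltW/ln_sublinear; rewrite divr_gt0.
rewrite ln_div ?posrE// => /(ler_wpM2l z0) H.
have : z * (t / (2 * z + 1)) <= t / 2.
  by rewrite mulrA ler_pdivrMr// mulrAC ler_pdivlMr//; nra.
by move: H; lra.
Qed.

Lemma ler_ln_tangent (c t : R) : 0 < c -> 0 < t -> ln t <= ln c + t / c - 1.
Proof.
move=> c0 t0; have := @le_ln1Dx R (t / c - 1).
have tc : 0 < t / c by rewrite divr_gt0.
rewrite [1 + _]addrC subrK ln_div ?posrE// => /(_ _).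
by move=> H; have := H ltac:(lra); lra.
Qed.

Lemma is_derive_inv_affine (a b t : R) : b + a * t != 0 ->
  is_derive t 1 (fun t : R => (b + a * t)^-1) (- a / (b + a * t) ^+ 2).
Proof.
move=> n0; have H : is_derive t (1 : R) (fun t => b + a * t) a.
  by apply: is_derive_eq; rewrite /= /GRing.scale /=; ring.
have D := @is_deriveV R (fun t => b + a * t) t a 1 n0 H.
by apply: is_derive_eq; rewrite /GRing.scale /=; ring.
Qed.

Lemma is_derive_ln1D (t : R) : 0 < 1 + t ->
  is_derive t 1 (fun t : R => ln (1 + t)) (1 + t)^-1.
Proof.
move=> t1; have H : is_derive t (1 : R) (fun t => 1 + t) 1.
  by apply: is_derive_eq (@is_deriveD R R R (cst 1) id t 1 0 1 _ _) _; rewrite add0r.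
have D := @is_derive1_comp R _ (fun t => 1 + t) t _ _ (is_derive1_ln t1) H.
by apply: is_derive_eq; rewrite mulr1.
Qed.

(** Both bounds are Padé approximants of [ln (1 + y)] at 0. Each difference vanishes at 0 and has an
    explicit positive derivative on the positive axis. *)
Lemma ln1D_bounds (y : R) : 0 < y ->
  2 * y / (2 + y) < ln (1 + y) < y * (6 + y) / (6 + 4 * y).
Proof.
move=> y0.
have incr (f df : R -> R) : (forall t : R, 0 <= t -> is_derive t (1 : R) f (df t)) ->
    (forall t, 0 < t -> 0 < df t) -> f 0 = 0 -> 0 < f y.
  move=> fd df0 f0.
  have [|||c /[!in_itv]/= /andP[c0 _]] := @MVT R f df 0 y.
  - by [].
  - by move=> t /[!in_itv]/= /andP[/ltW t0 _]; exact: fd.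
  - apply: derivable_within_continuous => t /[!in_itv]/= /andP[t0 _].
    by have [] := fd t t0.
  by rewrite f0 !subr0 => ->; rewrite mulr_gt0 ?df0.
apply/andP; split; rewrite -subr_gt0.
(* Partial fractions leave a single inverse of an affine function to differentiate. *)
- have -> : 2 * y / (2 + y) = 2 - 4 * (2 + 1 * y)^-1.
    by field; rewrite gt_eqF//; lra.
  apply: (incr (fun y => ln (1 + y) - (2 - 4 * (2 + 1 * y)^-1))
    (fun t => t ^+ 2 / ((1 + t) * (2 + t) ^+ 2))).
  + move=> t t0; have t1 : 0 < 1 + t by lra.
    have t2 : 2 + 1 * t != 0 by rewrite gt_eqF//; lra.
    have H1 := is_derive_ln1D _ t1; have H2 := is_derive_inv_affine _ _ _ t2.
    apply: is_derive_eq; rewrite /= /GRing.scale /=; field.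
    by apply/andP; split; rewrite gt_eqF//; lra.
  + by move=> t t0; rewrite divr_gt0 ?mulr_gt0 ?exprn_gt0//; lra.
  + by rewrite addr0 ln1; field.
- have -> : y * (6 + y) / (6 + 4 * y) = y / 4 + 9 / 8 - 27 / 4 * (6 + 4 * y)^-1.
    by field; rewrite gt_eqF//; lra.
  apply: (incr (fun y => y / 4 + 9 / 8 - 27 / 4 * (6 + 4 * y)^-1 - ln (1 + y))
    (fun t => 4 * t ^+ 3 / ((1 + t) * (6 + 4 * t) ^+ 2))).
  + move=> t t0; have t1 : 0 < 1 + t by lra.
    have t2 : 6 + 4 * t != 0 by rewrite gt_eqF//; lra.
    have H1 := is_derive_ln1D _ t1; have H2 := is_derive_inv_affine _ _ _ t2.
    apply: is_derive_eq; rewrite /= /GRing.scale /=; field.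
    by apply/andP; split; rewrite gt_eqF//; lra.
  + by move=> t t0; rewrite divr_gt0 ?mulr_gt0 ?exprn_gt0//; lra.
  + by rewrite addr0 ln1; field.
Qed.

(** After cross-multiplication the difference is [3 * x ^+ 3 * (m - 1)]. The value [3 * x / (6 + x)]
    is exactly the one that gives equality at [m = 1]. *)
Lemma ln1D_upper_bound_le (x m : R) : 0 < x -> 1 <= m ->
  x / m * (6 + x / m) / (6 + 4 * (x / m)) <= x / (3 * x / (6 + x) + m).
Proof.
move=> x0 m1; have mx : 0 < m * x by rewrite mulr_gt0//; lra.
have -> : x / m * (6 + x / m) / (6 + 4 * (x / m)) =
    x * (6 * m + x) / (m * (6 * m + 4 * x)).
  by field; lra.
have -> : x / (3 * x / (6 + x) + m) = x * (6 + x) / (m * (6 + x) + 3 * x).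
  by field; apply/andP; split; rewrite gt_eqF//; nra.
have d1 : 0 < m * (6 * m + 4 * x) by nra.
have d2 : 0 < m * (6 + x) + 3 * x by nra.
rewrite ler_pdivrMr// mulrAC ler_pdivlMr// -subr_ge0.
have -> : x * (6 + x) * (m * (6 * m + 4 * x)) -
    x * (6 * m + x) * (m * (6 + x) + 3 * x) = 3 * x ^+ 3 * (m - 1) by ring.
by rewrite mulr_ge0 ?mulr_ge0 ?exprn_ge0//; lra.
Qed.

End ElementaryBounds.

(** * Integrability of Euler's integrand and the functional equation of Gamma *)

Section EulerIntegral.
Context {R : realType}.
Notation mu := (@lebesgue_measure R).

Definition euler_integrand (z t : R) : R := t `^ (z - 1) * expR (- t).

(** Since [f] is nonnegative, its integral is that of its absolute value, so the finite value
    [l - F 0] also yields integrability. At 0 only right limits are required, which suits powers of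
    [t]. *)
Lemma ge0_FTC2_0y (f F : R -> R) (l : R) :
  (forall t : R, 0 <= t -> 0 <= f t) ->
  (forall t : R, 0 < t -> {for t, continuous f}) -> f t @[t --> 0^'+] --> f 0 ->
  (forall t : R, 0 < t -> is_derive t (1 : R) F (f t)) -> F t @[t --> 0^'+] --> F 0 ->
  F t @[t --> +oo] --> l ->
  mu.-integrable `]0, +oo[ (EFin \o f) /\
  \int[mu]_(t in `]0, +oo[) f t = l - F 0.
Proof.
move=> f0 cf cf0 dF cF0 Fl.
have cfy : {within `[0, +oo[, continuous f}.
  apply/continuous_within_itvcyP; split=> // t /[!in_itv]/= /andP[t0 _].
  exact: cf.
have dF1 (x : R) : 0 < x -> derivable F x 1 by move=> /dF[].
have dFE : {in `]0, +oo[%R, F^`()%classic =1 f}.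
  move=> x /[!in_itv]/= /andP[x0 _]; rewrite derive1E.
  by have /@derive_val := dF _ x0.
have I := ge0_continuous_FTC2y f0 cfy Fl dF1 cF0 dFE.
have mf : measurable_fun (`]0, +oo[ : set R) f.
  apply: open_continuous_measurable_fun => // x /set_mem /=.
  by rewrite in_itv/= andbT; exact: cf.
have If : (\int[mu]_(t in `]0%R, +oo[) (f t)%:E = (l - F 0)%:E)%E.
  by rewrite integral_itv_obnd_cbnd//; exact/measurable_EFinP.
split; last by rewrite /Rintegral If.
apply/integrableP; split; first exact/measurable_EFinP.
under eq_integral => x.
  rewrite inE/= in_itv/= andbT => /ltW x0.
  by rewrite ger0_norm ?f0//; over.
by rewrite If ltry.
Qed.

Lemma expRNhalf_cvg0 : expR (- (t / 2)) @[t --> +oo] --> (0 : R).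
Proof.
apply: (@cvg_comp _ _ _ (fun t : R => t / 2) (fun t => expR (- t)) _ +oo).
  by apply: gt0_cvgMly => //.
exact: cvgr_expR.
Qed.

Lemma is_derive_expRNhalf (t : R) :
  is_derive t (1 : R) (fun t => expR (- (t / 2))) (- (expR (- (t / 2)) / 2)).
Proof.
have H : is_derive t (1 : R) (fun t => - (t / 2)) (- 2^-1).
  by apply: is_derive_eq; rewrite /= /GRing.scale /=; ring.
have D := @is_derive1_comp R _ _ t _ _ (is_derive_expR (- (t / 2))) H.
by apply: is_derive_eq; ring.
Qed.

Lemma continuous_expRNhalf : continuous (fun t : R => expR (- (t / 2))).
Proof.
move=> t; apply/differentiable_continuous/derivable1_diffP.
by have [] := is_derive_expRNhalf t.
Qed.

Lemma integral_expRNhalf :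
  mu.-integrable `]0, +oo[ (EFin \o (fun t => expR (- (t / 2)))) /\
  \int[mu]_(t in `]0, +oo[) expR (- (t / 2)) = 2.
Proof.
have [||||||ih ->] := ge0_FTC2_0y (fun t => expR (- (t / 2)))
  (fun t => (- 2) * expR (- (t / 2))) 0.
- by move=> t _; exact: expR_ge0.
- by move=> t _; exact: continuous_expRNhalf.
- by apply: cvg_at_right_filter; exact: continuous_expRNhalf.
- move=> t _; have D := is_derive_expRNhalf t.
  by apply: is_derive_eq; rewrite /GRing.scale/=; field.
- by apply: cvg_at_right_filter; apply: cvgMr; exact: continuous_expRNhalf.
- by rewrite -(mulr0 (-2)); apply: cvgMr; exact: expRNhalf_cvg0.
by split=> //; rewrite mul0r oppr0 expR0; ring.
Qed.

Lemma euler_integrand_ge0 (z t : R) : 0 <= euler_integrand z t.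
Proof. by rewrite mulr_ge0 ?powR_ge0 ?expR_ge0. Qed.

Lemma measurable_euler_integrand (z : R) (D : set R) :
  measurable_fun D (euler_integrand z).
Proof.
apply: measurable_funTS; apply: measurable_funM; first exact: measurable_powR.
by apply: measurableT_comp => //; exact: measurable_expR.
Qed.

(** Domination by [powR_expRN_le] at the exponent [z - 1], which must be nonnegative. The range
    [1 <= z] suffices below, where every argument of Gamma is at least 1. *)
Lemma integrable_euler_integrand (z : R) : 1 <= z ->
  mu.-integrable `]0, +oo[ (EFin \o euler_integrand z).
Proof.
move=> z1; have [ih _] := integral_expRNhalf.
have z0 : 0 <= z - 1 by lra.
have := integrableZl _ ((2 * (z - 1) + 1) `^ (z - 1)) ih => /(_ ltac:(by [])).
apply: le_integrable => //.
  by apply/measurable_EFinP; exact: measurable_euler_integrand.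
move=> t /=; rewrite in_itv/= andbT => t0.
rewrite lee_fin !ger0_norm ?mulr_ge0 ?powR_ge0 ?expR_ge0//.
exact: powR_expRN_le.
Qed.

Lemma powR_cvg_at_right0 (z : R) : 0 <= z -> t `^ z @[t --> 0^'+] --> (0 : R) `^ z.
Proof.
rewrite le_eqVlt => /predU1P[<-|z0].
  (* For [z = 0] the power is constantly 1, also at [t = 0]. *)
  by under eq_fun do rewrite powRr0; rewrite powRr0; exact: cvg_cst.
by rewrite powR0 ?gt_eqF//; exact: powR_cvg0.
Qed.

Lemma continuous_powR (z t : R) : 0 < t -> {for t, continuous (@powR R ^~ z)}.
Proof.
move=> t0; apply/differentiable_continuous/derivable1_diffP.
by have [] := is_derive1_powR z t0.
Qed.

(* Integration by parts; the term in [K] makes the integrand nonnegative, as the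
   fundamental theorem of calculus on a half-line requires. *)
Lemma GammaS (z : R) : 1 <= z -> Gamma (z + 1) = z * Gamma z.
Proof.
move=> z1; pose K := (2 * z + 1) `^ z.
pose F t := euler_integrand (z + 1) t - 2 * K * expR (- (t / 2)).
pose f t := z * euler_integrand z t - euler_integrand (z + 1) t
            + K * expR (- (t / 2)).
have z0 : 0 <= z by lra.
have ez1 t : euler_integrand (z + 1) t = t `^ z * expR (- t).
  by rewrite /euler_integrand addrK.
have cexpN (t : R) : {for t, continuous (fun t => expR (- t))}.
  apply: continuous_comp; first exact: opp_continuous.
  exact: continuous_expR.
have cvg0 (a : R) : 1 <= a ->
    euler_integrand a t @[t --> 0^'+] --> euler_integrand a 0.
  move=> a1; apply: cvgM; first by apply: powR_cvg_at_right0; lra.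
  by apply: cvg_at_right_filter; exact: cexpN.
have cont (a t : R) : 0 < t -> {for t, continuous (euler_integrand a)}.
  move=> t0; apply: cvgM; first exact: continuous_powR.
  exact: cexpN.
have cvgh (c : R) (t : R) : c * expR (- (s / 2)) @[s --> t] --> c * expR (- (t / 2)).
  by apply: cvgMr; exact: continuous_expRNhalf.
have [||||||_] := @ge0_FTC2_0y f F 0.
- move=> t; rewrite le_eqVlt => /predU1P[<-|t0].
    rewrite /f ez1 powR0 ?gt_eqF//; last lra.
    by rewrite mul0r subr0 addr_ge0 ?mulr_ge0 ?powR_ge0 ?expR_ge0//.
  have := powR_expRN_le z t z0 t0; rewrite -/K -ez1 /f.
  by have := mulr_ge0 z0 (euler_integrand_ge0 z t); lra.
- move=> t t0; apply: cvgD; last exact: cvgh.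
  by apply: cvgB; [apply: cvgMr|]; exact: cont.
- apply: cvgD; last exact/cvg_at_right_filter/cvgh.
  by apply: cvgB; [apply: cvgMr|]; apply: cvg0; lra.
- move=> t t0; have D := is_derive_expRNhalf t.
  have N : is_derive t (1 : R) -%R (- 1) by exact: is_deriveNid.
  have E := @is_derive1_comp R _ _ t _ _ (is_derive_expR (- t)) N.
  have P := is_derive1_powR z t0.
  rewrite /F; under eq_fun do rewrite ez1.
  apply: is_derive_eq; rewrite /f /GRing.scale/= ez1 /euler_integrand.
  by field.
- apply: cvgB; last exact/cvg_at_right_filter/cvgh.
  by apply: cvg0; lra.
- rewrite -(subr0 0) -{2}(mulr0 (2 * K)); apply: cvgB; last first.
    by apply: cvgMr; exact: expRNhalf_cvg0.
  apply: (@squeeze_cvgr _ _ _ _ (cst 0) (fun t => K * expR (- (t / 2)))).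
  + near=> t; have t0 : 0 < t by near: t; exact: nbhs_pinfty_gt.
    by rewrite euler_integrand_ge0/= ez1; exact: powR_expRN_le.
  + exact: cvg_cst.
  + by rewrite -(mulr0 K); apply: cvgMr; exact: expRNhalf_cvg0.
have [ih Eh] := integral_expRNhalf.
have iz := integrable_euler_integrand z z1.
have iz1 : mu.-integrable `]0, +oo[ (EFin \o euler_integrand (z + 1)).
  by apply: integrable_euler_integrand; lra.
rewrite /f RintegralD//; last 2 first.
- exact: (integrableB _ (integrableZl _ z iz) iz1).
- exact: (integrableZl _ K ih).
rewrite RintegralB//; last exact: (integrableZl _ z iz).
(* The boundary value [F 0] is [- (2 * K)], so it cancels against the integral [2 * K] of the
   auxiliary term. *)
rewrite !RintegralZl// Eh /F ez1 powR0 ?gt_eqF//; last lra.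
rewrite !mul0r oppr0 expR0 /Gamma /euler_integrand; lra.
Unshelve. all: end_near. Qed.

End EulerIntegral.

(** * Value at 1 and positivity of Gamma; parameter derivative of the integrand *)

Section GammaDerivative.
Context {R : realType}.
Notation mu := (@lebesgue_measure R).

Lemma Gamma1 : Gamma 1 = 1 :> R.
Proof.
have e1 : euler_integrand 1 = (fun t : R => expR (- t)).
  by apply/funext => t; rewrite /euler_integrand subrr powRr0 mul1r.
have cexpN : continuous (fun t : R => expR (- t)).
  move=> t; apply: continuous_comp; first exact: opp_continuous.
  exact: continuous_expR.
have [||||||_ E] := ge0_FTC2_0y (euler_integrand 1) (fun t : R => - expR (- t)) 0.
- by move=> t _; exact: euler_integrand_ge0.
- by rewrite e1 => t _; exact: cexpN.
- by rewrite e1; apply: cvg_at_right_filter; exact: cexpN.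
- move=> t _.
  have N : is_derive t (1 : R) -%R (- 1) by exact: is_deriveNid.
  have E := @is_derive1_comp R _ _ t _ _ (is_derive_expR (- t)) N.
  by apply: is_derive_eq; rewrite e1; ring.
- by apply: cvg_at_right_filter; apply: cvgN; exact: cexpN.
- by rewrite -[X in _ --> X]oppr0; apply: cvgN; exact: cvgr_expR.
by rewrite /Gamma [LHS]E oppr0 expR0; ring.
Qed.

(** On [[1, 2]] the power is at least 1 and the exponential at least [expR (- 2)], so this interval
    alone contributes at least [expR (- 2)]. *)
Lemma Gamma_gt0 (z : R) : 1 <= z -> 0 < Gamma z.
Proof.
move=> z1; apply: (lt_le_trans (expR_gt0 (- 2))).
rewrite -lee_fin fineK; last first.
  exact: (integrable_fin_num _ (integrable_euler_integrand z z1)).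
have -> : (expR (-2))%:E = (\int[mu]_(t in `[1%R, 2%R]) (expR (-2))%:E)%E.
  rewrite integral_cst//= lebesgue_measure_itv/= lte_fin ltr1n -EFinB -EFinM.
  by congr EFin; ring.
apply: (@le_trans _ _ (\int[mu]_(t in `[1%R, 2%R]) (euler_integrand z t)%:E)%E).
  apply: ge0_le_integral => //.
  - by apply/measurable_EFinP; exact: measurable_euler_integrand.
  - move=> t /=; rewrite in_itv/= lee_fin => /andP[t1 t2].
    rewrite -[leLHS]mul1r ler_pM ?expR_ge0//; last by rewrite ler_expR; lra.
    by rewrite -[leLHS](powRr0 t) ler_powR//; lra.
apply: ge0_subset_integral => //.
- by apply/measurable_EFinP; exact: measurable_euler_integrand.
- by move=> t _; rewrite lee_fin euler_integrand_ge0.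
- by move=> t /=; rewrite !in_itv/= andbT => /andP[t1 _]; lra.
Qed.

Lemma is_derive_euler_integrand (t z : R) : 0 < t ->
  is_derive z (1 : R) (euler_integrand ^~ t) (ln t * euler_integrand z t).
Proof.
move=> t0; pose l := ln t.
have A : is_derive z (1 : R) (fun z => (z - 1) * l) l.
  by apply: is_derive_eq; rewrite /= /GRing.scale /=; ring.
have D := @is_derive1_comp R _ _ z _ _ (is_derive_expR ((z - 1) * l)) A.
have E : euler_integrand ^~ t = (fun z => expR ((z - 1) * l) * expR (- t)).
  by apply/funext => s; rewrite /euler_integrand /powR gt_eqF.
rewrite E; apply: is_derive_eq; rewrite /euler_integrand /powR gt_eqF//.
by rewrite /= /GRing.scale /= -/l; ring.
Qed.

(* Near 0 the logarithm is absorbed by [t `^ (u - 1)], near infinity by [t]. *)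
Lemma normr_ln_euler_integrand_le (u v z t : R) : 1 < u -> u <= z <= v -> 0 < t ->
  `|ln t * euler_integrand z t| <=
  (u - 1)^-1 * euler_integrand 1 t + euler_integrand (v + 1) t.
Proof.
move=> u1 /andP[uz zv] t0.
rewrite normrM (ger0_norm (euler_integrand_ge0 _ _)).
rewrite /euler_integrand subrr powRr0 addrK mul1r !mulrA -mulrDl.
rewrite ler_wpM2r ?expR_ge0//.
have tu0 : 0 < (u - 1)^-1 by rewrite invr_gt0; lra.
have [t1|t1] := leP 1 t.
- have : `|ln t| * t `^ (z - 1) <= t * t `^ (v - 1).
    rewrite ler_pM ?powR_ge0//; last by rewrite ler_powR; lra.
    by rewrite ger0_norm ?ln_ge0//; exact/ltW/ln_sublinear.
  rewrite mulr_powRB1; [|exact: ltW|lra].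
  by move=> /le_trans; apply; rewrite lerDr ltW.
- have : `|ln t| * t `^ (z - 1) <= `|ln t| * t `^ (u - 1).
    by rewrite ler_wpM2l// ger_powR//; [rewrite t0 ltW | lra].
  move=> /le_trans; apply; apply: (@le_trans _ _ (u - 1)^-1); last first.
    by rewrite lerDl powR_ge0.
  rewrite ltr0_norm ?ln_lt0 ?t0//.
  have p0 : 0 < t `^ (u - 1) by rewrite powR_gt0.
  have := @ln_sublinear R (t `^ (- (u - 1))).
  rewrite powR_gt0// ln_powR powRN => /(_ isT) /ltW H.
  have -> : - ln t * t `^ (u - 1) =
      (u - 1)^-1 * (- (u - 1) * ln t * t `^ (u - 1)) by field; lra.
  rewrite -[leRHS]mulr1 ler_wpM2l ?(ltW tu0)//.
  by rewrite -[leRHS](mulVf (lt0r_neq0 p0)) ler_wpM2r ?(ltW p0).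
Qed.

End GammaDerivative.

(** * Derivative of Gamma; logarithmic bounds and recurrence for digamma *)

Section DigammaBounds.
Context {R : realType}.
Notation mu := (@lebesgue_measure R).

Lemma integrable_ln_euler_bound (u v : R) : 1 <= v ->
  mu.-integrable `]0, +oo[
    (EFin \o (fun t => (u - 1)^-1 * euler_integrand 1 t + euler_integrand (v + 1) t)).
Proof.
move=> v1; have I1 := integrable_euler_integrand (1 : R) (lexx 1).
have I2 : mu.-integrable `]0, +oo[ (EFin \o euler_integrand (v + 1)).
  by apply: integrable_euler_integrand; lra.
exact: (integrableD _ (integrableZl _ (u - 1)^-1 I1) I2).
Qed.

Lemma integrable_ln_euler_integrand (z : R) : 1 < z ->
  mu.-integrable `]0, +oo[ (EFin \o (fun t => ln t * euler_integrand z t)).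
Proof.
move=> z1; pose u := (1 + z) / 2.
have := integrable_ln_euler_bound u z (ltW z1).
apply: le_integrable => //.
  apply/measurable_EFinP; apply: measurable_funM.
    by apply: measurable_funTS; exact: measurable_ln.
  exact: measurable_euler_integrand.
move=> t /=; rewrite in_itv/= andbT => t0.
rewrite lee_fin [leRHS]ger0_norm; last first.
  apply: addr_ge0; last exact: euler_integrand_ge0.
  by rewrite mulr_ge0 ?euler_integrand_ge0// invr_ge0 /u; lra.
by apply: normr_ln_euler_integrand_le; rewrite /u; lra.
Qed.

(** Differentiation under the integral sign. On the neighbourhood []u, v[] of [z] the majorant [G]
    does not depend on the parameter; taking [u] midway between 1 and [z] keeps [u - 1] positive. *)
Lemma is_derive_Gamma (z : R) : 1 < z ->
  is_derive z (1 : R) (@Gamma R)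
    (\int[mu]_(t in `]0, +oo[) (ln t * euler_integrand z t)).
Proof.
move=> z1; pose u := (1 + z) / 2; pose v := z + 1.
pose G t := (u - 1)^-1 * euler_integrand 1 t + euler_integrand (v + 1) t.
have uv : (`]u, v[ : set R) z by rewrite /= in_itv/= /u /v; apply/andP; split; lra.
have intf (x : R) : (`]u, v[ : set R) x ->
    mu.-integrable `]0, +oo[ (EFin \o euler_integrand x).
  rewrite /= in_itv/= /u => /andP[ux _].
  by apply: integrable_euler_integrand; lra.
have derf (x t : R) : (`]u, v[ : set R) x -> (`]0, +oo[ : set R) t ->
    derivable (euler_integrand ^~ t) x 1.
  move=> _ /=; rewrite in_itv/= andbT => t0.
  by have [] := is_derive_euler_integrand t x t0.
have dE (x t : R) : 0 < t ->
    partial1of2 euler_integrand x t = ln t * euler_integrand x t.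
  move=> t0; rewrite partial1of2E.
  by have /@derive_val := is_derive_euler_integrand t x t0.
have G0 t : 0 <= G t.
  apply: addr_ge0; last exact: euler_integrand_ge0.
  by rewrite mulr_ge0 ?euler_integrand_ge0// invr_ge0 /u; lra.
have iG : mu.-integrable `]0, +oo[ (EFin \o G).
  by apply: integrable_ln_euler_bound; rewrite /v; lra.
have Gub (x t : R) : (`]u, v[ : set R) x -> (`]0, +oo[ : set R) t ->
    `|partial1of2 euler_integrand x t| <= G t.
  rewrite /= !in_itv/= andbT => /andP[ux xv] t0; rewrite dE//.
  by apply: normr_ln_euler_integrand_le => //; [rewrite /u; lra | rewrite !ltW].
have D := derivable_under_integral (mu := mu) (measurable_itv _) uv intf derf G0 iG Gub.
have E := differentiation_under_integral (mu := mu) (measurable_itv _) uv intf derf G0 iG Gub.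
split; first exact: D.
rewrite -derive1E [LHS]E; apply: eq_Rintegral => t.
by rewrite inE/= in_itv/= andbT; exact: dE.
Qed.

(** Jensen's inequality for the Gamma distribution, whose mean is [z]: the tangent to [ln] at [z] is
    integrated, and [GammaS] makes its linear part cancel. *)
Lemma digamma_le_ln (z : R) : 1 < z -> digamma z <= ln z.
Proof.
move=> z1; have z0 : 0 < z by lra.
have Gz : 0 < Gamma z by apply: Gamma_gt0; lra.
rewrite /digamma derive1E; have /@derive_val -> := is_derive_Gamma z z1.
rewrite ler_pdivrMr//.
have -> : ln z * Gamma z = (ln z - 1) * Gamma z + z^-1 * Gamma (z + 1).
  by rewrite GammaS ?ltW//; field; lra.
have I1 := integrable_euler_integrand z (ltW z1).
have I2 : mu.-integrable `]0, +oo[ (EFin \o euler_integrand (z + 1)).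
  by apply: integrable_euler_integrand; lra.
have J1 : mu.-integrable `]0, +oo[
    (EFin \o (fun t => (ln z - 1) * euler_integrand z t)).
  exact: (integrableZl _ _ I1).
have J2 : mu.-integrable `]0, +oo[
    (EFin \o (fun t => z^-1 * euler_integrand (z + 1) t)).
  exact: (integrableZl _ _ I2).
rewrite -(RintegralZl _ _ I1)// -(RintegralZl _ _ I2)// -(RintegralD _ J1 J2)//.
apply: le_Rintegral => //.
- exact: integrable_ln_euler_integrand.
- exact: (integrableD _ J1 J2).
move=> t /=; rewrite in_itv/= andbT => t0.
have -> : euler_integrand (z + 1) t = t * euler_integrand z t.
  by rewrite /euler_integrand addrK mulrA mulr_powRB1// ltW.
rewrite [z^-1 * _]mulrA -mulrDl ler_wpM2r ?euler_integrand_ge0//.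
by have := ler_ln_tangent z t z0 t0; lra.
Qed.

(** Here the tangent is taken at [t] and evaluated at [z - 1]. Its term [(z - 1) / t] lowers the
    exponent and produces [Gamma (z - 1)], hence the range [2 <= z]. *)
Lemma ln_le_digamma (z : R) : 2 <= z -> ln (z - 1) <= digamma z.
Proof.
move=> z2; have z1 : 1 < z by lra.
have c0 : 0 < z - 1 by lra.
have Gz : 0 < Gamma z by apply: Gamma_gt0; lra.
rewrite /digamma derive1E; have /@derive_val -> := is_derive_Gamma z z1.
rewrite ler_pdivlMr//.
have -> : ln (z - 1) * Gamma z =
    (ln (z - 1) + 1) * Gamma z - (z - 1) * Gamma (z - 1).
  by rewrite -GammaS ?subrK; [ring|lra].
have I1 := integrable_euler_integrand z (ltW z1).
have I2 : mu.-integrable `]0, +oo[ (EFin \o euler_integrand (z - 1)).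
  by apply: integrable_euler_integrand; lra.
have J1 : mu.-integrable `]0, +oo[
    (EFin \o (fun t => (ln (z - 1) + 1) * euler_integrand z t)).
  exact: (integrableZl _ _ I1).
have J2 : mu.-integrable `]0, +oo[
    (EFin \o (fun t => (z - 1) * euler_integrand (z - 1) t)).
  exact: (integrableZl _ _ I2).
rewrite -(RintegralZl _ _ I1)// -(RintegralZl _ _ I2)// -(RintegralB _ J1 J2)//.
apply: le_Rintegral => //.
- exact: (integrableB _ J1 J2).
- exact: integrable_ln_euler_integrand.
move=> t /=; rewrite in_itv/= andbT => t0.
have -> : euler_integrand z t = t * euler_integrand (z - 1) t.
  by rewrite /euler_integrand mulrA mulr_powRB1// ltW.
rewrite [_ * (t * _)]mulrA [ln t * _]mulrA -mulrBl ler_wpM2r ?euler_integrand_ge0//.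
have := ler_ln_tangent t (z - 1) t0 c0.
move=> /(ler_wpM2r (ltW t0)).
by rewrite mulrBl mulrDl divfK ?gt_eqF// mul1r mulrDl mul1r; lra.
Qed.

Lemma digammaS (z : R) : 1 < z -> digamma (z + 1) = digamma z + z^-1.
Proof.
move=> z1; have z0 : 0 < z by lra.
have Gz : 0 < Gamma z by apply: Gamma_gt0; lra.
have Dz := is_derive_Gamma z z1.
have z1' : 1 < z + 1 by lra.
have Dz1 := is_derive_Gamma (z + 1) z1'.
have S : is_derive z (1 : R) (fun w => w + 1) 1.
  by apply: is_derive_eq (@is_deriveD R R R id (cst 1) z 1 1 0 _ _) _; rewrite addr0.
have L := @is_derive1_comp R (@Gamma R) (fun w => w + 1) z _ _ Dz1 S.
have M := @is_deriveM R R id (@Gamma R) z 1 _ _ (is_derive_id z 1) Dz.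
have /@derive_val EL := L; have /@derive_val EM := M.
have E : 'D_1 (@Gamma R \o (fun w => w + 1)) z = 'D_1 (id * @Gamma R) z.
  (* [GammaS] is available from 1 onwards only, so the two functions are compared near [z]. *)
  apply: near_eq_derive => //; near=> w; rewrite /= GammaS// ltW//.
  by near: w; exact: lt_nbhsr.
rewrite /digamma !derive1E.
have /@derive_val -> := Dz; have /@derive_val -> := Dz1.
move: E; rewrite EL EM mulr1 => ->; rewrite GammaS ?ltW// /GRing.scale/=.
by field; lra.
Unshelve. all: end_near. Qed.

End DigammaBounds.

(** * Telescoping sums and their remainder *)

Section DigammaSum.
Context {R : realType}.

Lemma is_derive_lnGamma (z : R) : 1 < z ->
  is_derive z (1 : R) (fun z => ln (Gamma z)) (digamma z).
Proof.
move=> z1; have Gz : 0 < Gamma z by apply: Gamma_gt0; lra.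
have Dz := is_derive_Gamma z z1.
have D := @is_derive1_comp R (@ln R) (@Gamma R) z _ _ (is_derive1_ln Gz) Dz.
apply: is_derive_eq; rewrite /digamma derive1E mulrC.
by have /@derive_val -> := Dz.
Qed.

Lemma additive_recurrence_iter (f g : R -> R) (z : R) (N : nat) :
  (forall w, z <= w -> f (w + 1) = f w + g w) ->
  f (z + N%:R) = f z + \sum_(n < N) g (z + n%:R).
Proof.
move=> fS; elim: N => [|N IH]; first by rewrite big_ord0 !addr0.
by rewrite big_ord_recr/= addrA -IH -natr1 addrA fS// lerDl.
Qed.

(** Only the recurrences matter, so [L] and [psi] stand for [ln] of Gamma and digamma. Unrolling [L]
    from [x + 1] and from 1 gives the logarithms of [x + m] and [m], whose quotient is [1 + x / m];
    unrolling [psi] gives the terms [x / (u + m)]. *)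
Lemma recurrence_telescope (L psi : R -> R) (x u : R) (N : nat) :
  0 <= x -> 0 < u ->
  L 1 = 0 -> (forall w, 1 <= w -> L (w + 1) = L w + ln w) ->
  (forall w, 1 < w -> psi (w + 1) = psi w + w^-1) ->
  L (x + 1) - x * psi (u + 1) +
    \sum_(n < N) (ln (1 + x / n.+1%:R) - x / (u + n.+1%:R)) =
  L (N%:R + 1 + x) - L (N%:R + 1) - x * psi (N%:R + 1 + u).
Proof.
move=> x0 u0 L1 LS psiS.
have -> : N%:R + 1 + x = (x + 1) + N%:R by ring.
have -> : N%:R + 1 + u = (u + 1) + N%:R by ring.
have -> : N%:R + 1 = 1 + N%:R :> R by ring.
rewrite (@additive_recurrence_iter L (@ln R) (x + 1)); last first.
  by move=> w xw; apply: LS; lra.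
rewrite (@additive_recurrence_iter L (@ln R) 1)// L1.
rewrite (@additive_recurrence_iter psi GRing.inv (u + 1)); last first.
  by move=> w uw; apply: psiS; lra.
rewrite sumrB -mulr_sumr.
have -> : \sum_(n < N) ln (1 + x / n.+1%:R) =
    \sum_(n < N) ln (x + 1 + n%:R) - \sum_(n < N) ln (1 + n%:R : R).
  rewrite -sumrB; apply: eq_bigr => n _.
  have n0 := ler0n R n.
  rewrite -ln_div ?posrE; [|lra|lra].
  by rewrite -natr1; congr ln; field; lra.
have -> : \sum_(n < N) (u + n.+1%:R)^-1 = \sum_(n < N) (u + 1 + n%:R)^-1.
  by apply: eq_bigr => n _; rewrite -natr1; congr (_^-1); ring.
by ring.
Qed.

Lemma ler_dist_itv (a e p q : R) :
  a <= p <= a + e -> a <= q <= a + e -> `|p - q| <= e.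
Proof.
by move=> /andP[? ?] /andP[? ?]; rewrite ler_norml; apply/andP; split; lra.
Qed.

(** The mean value theorem turns the increment into [x * digamma w]. As [u <= x], both [w] and
    [c + 1 + u] lie in [[c + 1, c + 1 + x]], where digamma varies by at most [(1 + x) / c]. *)
Lemma lnGamma_increment_digamma (x u c : R) : 1 <= c -> 0 < u <= x ->
  `|ln (Gamma (c + 1 + x)) - ln (Gamma (c + 1)) - x * digamma (c + 1 + u)| <=
  x * (1 + x) / c.
Proof.
move=> c1 /andP[u0 ux]; have x0 : 0 < x by lra.
have [|||w] := @MVT R (fun z => ln (Gamma z)) (@digamma R) (c + 1) (c + 1 + x).
- by lra.
- by move=> w /[!in_itv]/= /andP[cw _]; apply: is_derive_lnGamma; lra.
- apply: derivable_within_continuous => w /[!in_itv]/= /andP[cw _].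
  have w1 : 1 < w by lra.
  by have [] := is_derive_lnGamma w w1.
rewrite in_itv/= => /andP[cw wx] ->.
rewrite [c + 1 + x - _]addrC addKr [digamma w * _]mulrC -mulrBr.
rewrite normrM gtr0_norm// -mulrA; apply: ler_wpM2l; first exact: ltW.
have bounds (z : R) : c + 1 <= z <= c + 1 + x ->
    ln c <= digamma z <= ln c + (1 + x) / c.
  move=> /andP[z1 z2]; apply/andP; split.
    apply: le_trans (ln_le_digamma z _); last by lra.
    by rewrite ler_ln ?posrE; lra.
  apply: le_trans (digamma_le_ln z _) _; first by lra.
  have cz : 0 < z by lra.
  apply: le_trans (ler_ln_tangent c z _ cz) _; first lra.
  rewrite -addrA lerD2l lerBlDr -[X in _ + X](@divff _ c) ?gt_eqF//; last lra.
  by rewrite -mulrDl ler_pM2r ?invr_gt0; lra.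
by apply: ler_dist_itv; apply: bounds; apply/andP; split; lra.
Qed.

Lemma lnGamma_digamma_approx (x u : R) (N : nat) : 0 < u <= x ->
  `|ln (Gamma (x + 1)) - x * digamma (u + 1) +
    \sum_(n < N.+1) (ln (1 + x / n.+1%:R) - x / (u + n.+1%:R))| <=
  x * (1 + x) / N.+1%:R.
Proof.
move=> ux; have /andP[u0 lux] := ux; have x0 : 0 <= x by lra.
rewrite (@recurrence_telescope (fun z => ln (Gamma z)) (@digamma R) x u)//.
- by apply: lnGamma_increment_digamma; rewrite ?ler1n.
- by rewrite Gamma1 ln1.
- move=> w w1; have Gw := Gamma_gt0 w w1.
  have w0 := lt_le_trans ltr01 w1.
  by rewrite GammaS// lnM ?posrE//; exact: addrC.
- exact: digammaS.
Qed.

(** To get a strict sign without passing to the limit, [N] is chosen so large that the error is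
    below [a 0]; the other terms are nonnegative. *)
Lemma lt0_of_sum_approx (D C : R) (a : nat -> R) :
  (forall N, `|D + \sum_(n < N.+1) a n| <= C / N.+1%:R) ->
  (forall n, 0 < a n) -> D < 0.
Proof.
move=> H a0; have C0 : 0 <= C.
  by have := le_trans (normr_ge0 _) (H 0%N); rewrite divr1.
have [N CN] : exists N, C / N.+1%:R < a 0%N.
  exists (Num.bound (C / a 0%N)).
  rewrite ltr_pdivrMr// -ltr_pdivrMl// mulrC.
  apply: lt_le_trans (archi_boundP _) _; first by rewrite divr_ge0// ltW.
  by rewrite ler_nat.
have S0 : 0 <= \sum_(i < N) a i.+1 by apply: sumr_ge0 => i _; rewrite ltW.
have E : \sum_(n < N.+1) a n = a 0%N + \sum_(i < N) a i.+1 by rewrite big_ord_recl.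
have := H N; rewrite E ler_norml => /andP[_ /le_lt_trans /(_ CN)].
by rewrite addrCA gtrDl; apply: le_lt_trans; rewrite lerDl.
Qed.

End DigammaSum.

(* Both inequalities, from the signs of the summands *)
Local Close Scope classical_set_scope.

Theorem theorem2p4 (R : realType) (x : R) (hx : 0 < x) :
  expR (x * digamma (x / 2 + 1 - x ^+ 2 / (12 + 2 * x))) < Gamma (x + 1)
    < expR (x * digamma (x / 2 + 1)).
Proof.
have Gx : 0 < Gamma (x + 1) by apply: Gamma_gt0; lra.
rewrite -[Gamma (x + 1)]lnK ?posrE// !ltr_expR.
have y0 (n : nat) : 0 < x / n.+1%:R by rewrite divr_gt0.
have n1 (n : nat) : 1 <= n.+1%:R :> R by rewrite ler1n.
apply/andP; split.
- have -> : x / 2 + 1 - x ^+ 2 / (12 + 2 * x) = 3 * x / (6 + x) + 1.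
    by field; rewrite !gt_eqF//; lra.
  set u := 3 * x / (6 + x).
  have ux : 0 < u <= x.
    apply/andP; split; first by rewrite divr_gt0 ?mulr_gt0//; lra.
    by rewrite ler_pdivrMr; nra.
  (* The summands are negative for this [u], so the approximation is used with all signs
     reversed. *)
  rewrite -subr_lt0; apply: (@lt0_of_sum_approx _ _ (x * (1 + x))
    (fun n => - (ln (1 + x / n.+1%:R) - x / (u + n.+1%:R)))) => [N|n].
    by rewrite -normrN opprD opprB sumrN opprK; exact: lnGamma_digamma_approx.
  rewrite oppr_gt0 subr_lt0.
  have /andP[_ /lt_le_trans] := ln1D_bounds _ (y0 n); apply.
  exact: ln1D_upper_bound_le.
- rewrite -subr_lt0; apply: (@lt0_of_sum_approx _ _ (x * (1 + x))
    (fun n => ln (1 + x / n.+1%:R) - x / (x / 2 + n.+1%:R))) => [N|n].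
    by apply: lnGamma_digamma_approx; apply/andP; split; lra.
  rewrite subr_gt0.
  have /andP[/(le_lt_trans _) + _] := ln1D_bounds _ (y0 n); apply.
  have m1 := n1 n; set m : R := n.+1%:R in m1 *.
  (* With [y = x / m], the lower bound [2 * y / (2 + y)] equals [x / (x / 2 + m)]. *)
  by rewrite le_eqVlt; apply/orP; left; apply/eqP; field; lra.
Qed.
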